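(* Let $\mathbf{P}\in\mathbb{R}^{N\times N}$ be a diagonal matrix with positive diagonal entries $p_{ii}$, let $\mathbf{U}\in\mathbb{R}^{N\times s}$ ($N>s$) have orthonormal columns, let $c,\nu$ be positive integers, and let $\eta_i=\min\{1,c\,\xi_i(\mathbf{U})\}>0$ for $i=1,\dots,N$. For $t=1,\dots,\nu$ and $i=1,\dots,N$ let $\gamma_i^{(t)}$ be independent Bernoulli random variables with $\mathbb{P}(\gamma_i^{(t)}=1)=\eta_i$, let $\mathbf{S}_t=\mathrm{diag}\bigl(\gamma_1^{(t)}/\sqrt{\eta_1},\dots,\gamma_N^{(t)}/\sqrt{\eta_N}\bigr)$, and put $\mathbf{Y}(\mathbf{P})=\mathbf{U}^\top\mathbf{P}\mathbf{U}$ and $\bar{\mathbf{Y}}(\mathbf{P})=\frac1\nu\sum_{t=1}^\nu\mathbf{U}^\top\mathbf{P}^{1/2}\mathbf{S}_t^\top\mathbf{S}_t\mathbf{P}^{1/2}\mathbf{U}$. Then the Frobenius-variance of the average sketch is $$\mathbb{V}(\bar{\mathbf{Y}}(\mathbf{P}))=\frac1\nu\sum_{i=1}^N\Bigl(\frac1{\eta_i}-1\Bigr)p_{ii}^2\,\ell_i(\mathbf{U})^2.$$ If, additionally, $\eta_i=\frac cs\ell_i(\mathbf{U})$ with $\eta_i<\frac12$ for all $i\in\{1,\dots,N\}$, then $$\mathbb{V}(\bar{\mathbf{Y}}(\mathbf{P}))\le\frac1\nu\sum_{i=1}^Np_{ii}^2\Bigl(\frac sc-\ell_i(\mathbf{U})\Bigr)\ell_i(\mathbf{U})$$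 and, for every $\epsilon>0$, $$\mathbb{P}\bigl(\|\bar{\mathbf{Y}}(\mathbf{P})-\mathbf{Y}(\mathbf{P})\|_{\mathrm F}\ge\epsilon\bigr)\le\frac{s}{\nu c\,\epsilon^2}\sum_{i=1}^Np_{ii}^2\,\ell_i(\mathbf{U}).$$
   Context: $\ell_i(\mathbf{U})=\|\mathbf{u}_{(i)}\|^2$ is the leverage score of the $i$-th row $\mathbf{u}_{(i)}$ of $\mathbf{U}$, and $\xi_i(\mathbf{U})=s^{-1}\ell_i(\mathbf{U})$. The Frobenius-variance is the sum of the entrywise variances, $\mathbb{V}(\bar{\mathbf{Y}}(\mathbf{P}))=\sum_{h,k=1}^s\mathbb{V}(\bar y_{hk}(\mathbf{P}))=\mathbb{E}\bigl[\|\bar{\mathbf{Y}}(\mathbf{P})-\mathbf{Y}(\mathbf{P})\|_{\mathrm F}^2\bigr]$. *)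

(* Defs.v *)
From mathcomp Require Export all_boot all_order all_algebra.
From mathcomp Require Export all_classical all_reals all_analysis.
Export numFieldNormedType.Exports.

Set Implicit Arguments.
Unset Strict Implicit.
Unset Printing Implicit Defensive.
Import Order.TTheory GRing.Theory Num.Theory.

Local Open Scope classical_set_scope.
Local Open Scope ring_scope.

(* The canonical norm `|A| on matrices is the sup norm, so the Frobenius norm
   (the Euclidean norm, when A is a row vector) is defined here. *)
Definition frobenius_norm (R : rcfType) (m n : nat) (A : 'M[R]_(m, n)) : R :=
  Num.sqrt (\sum_i \sum_j A i j ^+ 2).

Definition leverage (R : rcfType) (N s : nat) (U : 'M[R]_(N, s)) (i : 'I_N) : R :=
  frobenius_norm (row i U) ^+ 2.

Definition leverage_prob (R : rcfType) (N s : nat) (U : 'M[R]_(N, s))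
    (i : 'I_N) : R :=
  s%:R^-1 * leverage U i.

(* P^(1/2), for P diagonal with nonnegative entries. *)
Definition diag_sqrt (R : rcfType) (N : nat) (P : 'M[R]_N) : 'M[R]_N :=
  diag_mx (\row_i Num.sqrt (P i i)).

Definition mutually_independent (R : realType) (d d' : measure_display)
    (Omega : measurableType d) (T : measurableType d') (Pr : probability Omega R)
    (I : finType) (X : I -> {RV Pr >-> T}) : Prop :=
  forall (J : {set I}) (A : I -> set T),
    (forall i, i \in J -> measurable (A i)) ->
    Pr (\bigcap_(i in [set` J]) (X i @^-1` A i)) =
    (\prod_(i in J) Pr (X i @^-1` A i))%E.

Definition frobenius_variance (R : realType) (d : measure_display)
    (Omega : measurableType d) (Pr : probability Omega R) (m n : nat)
    (Y : Omega -> 'M[R]_(m, n)) : \bar R :=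
  (\sum_h \sum_k 'V_Pr[fun w => Y w h k])%E.

Definition sampling_mx (R : rcfType) (N : nat) (eta : 'I_N -> R)
    (g : 'I_N -> bool) : 'M[R]_N :=
  diag_mx (\row_i ((g i)%:R / Num.sqrt (eta i))).

Definition gram (R : rcfType) (N s : nat) (U : 'M[R]_(N, s)) (P : 'M[R]_N) :
    'M[R]_s :=
  U^T *m P *m U.

Definition avg_sketch (R : rcfType) (N s nu : nat) (U : 'M[R]_(N, s))
    (P : 'M[R]_N) (eta : 'I_N -> R) (g : 'I_nu -> 'I_N -> bool) : 'M[R]_s :=
  nu%:R^-1 *: \sum_t (U^T *m diag_sqrt P *m (sampling_mx eta (g t))^T
                      *m sampling_mx eta (g t) *m diag_sqrt P *m U).

(* Main.v *)
(* Put Z_ti = gamma_i^(t) / eta_i.  Since P is diagonal, the (h,k) entry of the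
   average sketch is the linear combination nu^-1 sum_(t,i) p_ii u_ih u_ik Z_ti
   of pairwise independent variables of mean 1 and variance 1/eta_i - 1.
   Variances add, and summing over h, k collapses sum_(h,k) (u_ih u_ik)^2 into
   l_i^2.  The tail bound is Markov's inequality for the squared Frobenius
   norm of the deviation, whose expectation is the Frobenius variance. *)
Require Import Defs.
From mathcomp Require Import measurable_realfun ring.

Set Implicit Arguments.
Unset Strict Implicit.
Unset Printing Implicit Defensive.
Import Order.TTheory GRing.Theory Num.Theory.

Local Open Scope classical_set_scope.
Local Open Scope ring_scope.

(** * Variances of uncorrelated sums, indicators, and a Frobenius-norm tail bound *)

Section probability_lemmas.
Context d (T : measurableType d) (R : realType) (Pr : probability T R).
Local Open Scope ereal_scope.

Let PrT : Pr setT \is a fin_num := fin_num_measure Pr _ measurableT.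

Lemma Lfun_sum (I : Type) (p : R) (p1 : (1 <= p)%R) (r : seq I)
    (X : I -> T -> R) :
  (forall i, X i \in Lfun Pr p%:E) ->
  (fun w => \sum_(i <- r) X i w)%R \in Lfun Pr p%:E.
Proof.
move=> LX.
have pe : 1 <= p%:E by rewrite lee_fin.
rewrite (_ : (fun w => _) = \sum_(i <- r) X i)%R; last first.
  by apply/funext => w; rewrite fct_sumE.
exact: rpred_sum.
Qed.

Lemma covariance_suml (I : Type) (r : seq I) (X : I -> T -> R) (Y : T -> R) :
  (forall i, X i \in Lfun Pr 2%:E) -> Y \in Lfun Pr 2%:E ->
  covariance Pr (fun w => \sum_(i <- r) X i w)%R Y =
  \sum_(i <- r) covariance Pr (X i) Y.
Proof.
move=> LX LY; elim: r => [|i r IH].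
  rewrite big_nil (_ : (fun w => _) = cst 0%R) ?covariance_cst_l//.
  by apply/funext => w; rewrite big_nil.
rewrite big_cons -IH -covarianceDl//.
  2: by apply: Lfun_sum => //; rewrite ler1n.
by congr covariance; apply/funext => w; rewrite big_cons.
Qed.

(** Bilinearity expands the variance into the double sum of all covariances, of which only the
    diagonal survives. *)
Lemma variance_sum_uncorrelated (I : finType) (X : I -> T -> R) :
  (forall i, X i \in Lfun Pr 2%:E) ->
  (forall i j, i != j -> covariance Pr (X i) (X j) = 0) ->
  'V_Pr[(fun w => \sum_i X i w)%R] = \sum_i 'V_Pr[X i].
Proof.
move=> LX X0; rewrite /variance covariance_suml//.
  2: by apply: Lfun_sum => //; rewrite ler1n.
apply: eq_bigr => i _; rewrite covarianceC covariance_suml//.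
by rewrite (bigD1 i)//= big1 ?adde0// => j; exact: X0.
Qed.

(** An indicator equals its own [p]-th power, so the integral of that power is [Pr A], which is at
    most 1. *)
Lemma Lfun_indic (p : R) (p1 : (1 <= p)%R) (A : set T) : measurable A ->
  (\1_A : T -> R) \in Lfun Pr p%:E.
Proof.
move=> mA; rewrite inE; apply/andP; split; rewrite inE//=.
rewrite /finite_norm unlock poweR_lty//.
under eq_integral => x _.
  rewrite (_ : _ `^ p = (\1_A x)%:E); first over.
  rewrite -[LHS]/((`|\1_A x| `^ p)%R%:E) indicE.
  case: (_ \in _); rewrite ?normr1 ?powR1// normr0 powR0//.
  by rewrite gt_eqF// (lt_le_trans ltr01).
by rewrite integral_indic// setIT (le_lt_trans (probability_le1 _ mA)) ?ltry.
Qed.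

Lemma covariance_indic (A B : set T) : measurable A -> measurable B ->
  covariance Pr (\1_A : T -> R) (\1_B : T -> R) = Pr (A `&` B) - Pr A * Pr B.
Proof.
move=> mA mB.
have AB : (\1_A * \1_B = \1_(A `&` B) :> (T -> R))%R by rewrite indicI.
rewrite covarianceE ?AB ?Lfun_indic ?ler1n//; try exact: measurableI.
by rewrite !expectation_indic//; exact: measurableI.
Qed.

Lemma frobenius_chebyshev (m n : nat) (Y : T -> 'M[R]_(m, n)) (M : 'M[R]_(m, n))
    (eps : R) :
  (forall h k, measurable_fun setT (fun w => Y w h k)) ->
  (forall h k, 'E_Pr[fun w => Y w h k] = (M h k)%:E) -> (0 < eps)%R ->
  Pr [set w | (eps <= frobenius_norm (Y w - M))%R] <=
    (eps ^- 2)%:E * frobenius_variance Pr Y.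
Proof.
move=> mY EY eps0.
pose X w := (frobenius_norm (Y w - M) ^+ 2)%R.
have XE w : X w = (\sum_h \sum_k (Y w h k - M h k) ^+ 2)%R.
  rewrite /X /frobenius_norm sqr_sqrtr; last first.
    by apply: sumr_ge0 => h _; apply: sumr_ge0 => k _; exact: sqr_ge0.
  by apply: eq_bigr => h _; apply: eq_bigr => k _; rewrite !mxE.
have mD h k : measurable_fun setT (fun w => (Y w h k - M h k) ^+ 2)%R.
  by apply: measurable_funX; apply: measurable_funB.
have mX : measurable_fun setT X.
  rewrite (funext XE : X = _).
  by apply: measurable_sum => h; exact: measurable_sum.
(* Nonnegativity lets the integral pass through both sums; since [M] is the entrywise mean, each
   term is then literally a variance. *)
have EX : 'E_Pr[X] = frobenius_variance Pr Y.
  rewrite expectation.unlock.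
  under eq_integral do rewrite XE -sumEFin.
  rewrite ge0_integral_sum//.
  - apply: eq_bigr => h _.
    under eq_integral do rewrite -sumEFin.
    rewrite ge0_integral_sum//.
    + apply: eq_bigr => k _.
      rewrite /variance covariance.unlock expectation.unlock.
      apply: eq_integral => w _; congr EFin.
      by move: (EY h k); rewrite expectation.unlock => ->.
    + by move=> k; exact/measurable_EFinP.
    + by move=> k w _; rewrite lee_fin sqr_ge0.
  - by move=> h; apply/measurable_EFinP; exact: measurable_sum.
  - by move=> h w _; rewrite lee_fin sumr_ge0// => k _; exact: sqr_ge0.
pose XRV : {RV Pr >-> R} := mfun_Sub (mem_set mX).
(* [X] is already the square of the norm, so Markov's inequality is used with the identity function
   and threshold [eps ^+ 2]. *)
have := @markov _ _ _ Pr XRV id _ (exprn_gt0 2 eps0) _ _ _.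
move=> /(_ (@measurable_id _ _ _) (fun _ => id) (fun x y _ _ => id)).
rewrite lee_pdivlMl ?exprn_gt0// -EX.
have -> : (idfun \o (fun x : R => `|x|) \o XRV)%R = X.
  by apply/funext => w /=; rewrite ger0_norm ?sqr_ge0.
(* The two events coincide, because squaring preserves and reflects order on nonnegative reals. *)
apply: le_trans; rewrite le_eqVlt; apply/orP; left; apply/eqP.
congr (_ * Pr _); apply/seteqP; split => w /=;
  rewrite lee_fin ger0_norm ?sqr_ge0// ler_sqr//
    nnegrE ?sqrtr_ge0 ?(ltW eps0)//.
Qed.

Lemma expectation_sum_fun (I : Type) (r : seq I) (X : I -> T -> R) :
  (forall i, X i \in Lfun Pr 1) ->
  'E_Pr[(fun w => \sum_(i <- r) X i w)%R] = \sum_(i <- r) 'E_Pr[X i].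
Proof.
move=> LX; elim: r => [|i r IH].
  rewrite big_nil (_ : (fun w => _) = cst 0%R) ?expectation_cst//.
  by apply/funext => w; rewrite big_nil.
rewrite big_cons -IH -expectationD//; last exact: Lfun_sum.
by congr expectation; apply/funext => w; rewrite big_cons.
Qed.

(** * Mean and variance of a weighted sum of indicators *)

Section weighted_events.
Variables (I : finType) (A : I -> set T) (p a : I -> R).
Hypothesis mA : forall i, measurable (A i).
Hypothesis PrA : forall i, Pr (A i) = (p i)%:E.

Let X := (fun w => \sum_i \1_(A i) w * a i)%R.

Lemma measurable_weighted_indic : measurable_fun setT X.
Proof.
by apply: measurable_sum => i; exact: measurable_funM.
Qed.

Lemma expectation_weighted_indic : 'E_Pr[X] = (\sum_i p i * a i)%:E.
Proof.
rewrite expectation_sum_fun => [|i]; last exact/Lfun_scale/Lfun_indic.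
rewrite -sumEFin; apply: eq_bigr => i _.
rewrite (@expectationZl _ _ _ _ (\1_(A i))) ?Lfun_indic//.
by rewrite expectation_indic// PrA muleC.
Qed.

(** The indicator of [A i] has variance [p i * (1 - p i)], and the weight enters squared. Pairwise
    independence makes the cross covariances vanish. *)
Lemma variance_weighted_indic :
  (forall i j, i != j -> Pr (A i `&` A j) = Pr (A i) * Pr (A j)) ->
  'V_Pr[X] = (\sum_i a i ^+ 2 * (p i * (1 - p i)))%:E.
Proof.
move=> indep.
have L2 i : (\1_(A i) : T -> R) \in Lfun Pr 2%:E by rewrite Lfun_indic// ler1n.
rewrite (@variance_sum_uncorrelated _ (fun i => a i \o* \1_(A i)))%R.
- rewrite -sumEFin; apply: eq_bigr => i _.
  rewrite varianceZ// /variance covariance_indic// setIid PrA.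
  by rewrite mulrBr mulr1.
- by move=> i; apply: Lfun_scale => //; rewrite ler1n.
- move=> i j ij; have aj2 : (a j \o* \1_(A j))%R \in Lfun Pr 2%:E.
    by apply: Lfun_scale => //; rewrite ler1n.
  rewrite covarianceZl ?covarianceZr ?covariance_indic ?indep//.
  all: try exact: Lfun2_mul_Lfun1.
  all: try exact: Lfun_subset12.
  by rewrite !PrA subee// !mule0.
Qed.

End weighted_events.
End probability_lemmas.

(** * Entrywise formulas for the Gram matrix and the sketch *)

Section sketch.
Context (R : rcfType) (N s : nat) (U : 'M[R]_(N, s)) (P : 'M[R]_N).

Lemma leverageE i : leverage U i = \sum_k U i k ^+ 2.
Proof.
rewrite /leverage /frobenius_norm sqr_sqrtr; last first.
  by apply: sumr_ge0 => h _; apply: sumr_ge0 => k _; exact: sqr_ge0.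
by rewrite big_ord1; apply: eq_bigr => k _; rewrite mxE.
Qed.

(** The right side is the squared Frobenius norm of the rank-one matrix formed from row [i] of [U];
    it factors as a product of two equal sums. *)
Lemma leverage_sqr i :
  leverage U i ^+ 2 = \sum_h \sum_k (U i h * U i k) ^+ 2.
Proof.
rewrite leverageE expr2 mulr_suml; apply: eq_bigr => h _.
by rewrite mulr_sumr; apply: eq_bigr => k _; rewrite exprMn.
Qed.

Lemma gram_diagE (D : 'rV[R]_N) h k :
  gram U (diag_mx D) h k = \sum_i D 0 i * (U i h * U i k).
Proof.
rewrite /gram mul_mx_diag mxE; apply: eq_bigr => i _; rewrite !mxE.
by rewrite mulrCA mulrA.
Qed.

(** The four inner diagonal factors multiply to a single diagonal matrix, so each summand is itself
    a Gram matrix. The square roots pair up into [P i i / eta i], and the Boolean [g t i], read as 0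
    or 1, equals its square. *)
Lemma avg_sketchE (nu : nat) (eta : 'I_N -> R) (g : 'I_nu -> 'I_N -> bool) h k :
  (forall i, 0 <= P i i) -> (forall i, 0 <= eta i) ->
  avg_sketch U P eta g h k =
  \sum_(ti : 'I_nu * 'I_N) (g ti.1 ti.2)%:R *
    (nu%:R^-1 * (P ti.2 ti.2 / eta ti.2 * (U ti.2 h * U ti.2 k))).
Proof.
move=> P0 eta0; rewrite /avg_sketch mxE summxE mulr_sumr.
rewrite -(pair_bigA _ (fun t i => (g t i)%:R *
    (nu%:R^-1 * (P i i / eta i * (U i h * U i k)))))/=.
apply: eq_bigr => t _.
rewrite /diag_sqrt /sampling_mx tr_diag_mx -!mulmxA.
rewrite (mulmxA (diag_mx _) (diag_mx _)).
rewrite mulmx_diag (mulmxA (diag_mx _) (diag_mx _)) mulmx_diag.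
rewrite (mulmxA (diag_mx _) (diag_mx _)) mulmx_diag mulmxA.
rewrite -/(gram _ _) gram_diagE mulr_sumr; apply: eq_bigr => i _.
rewrite !mxE.
have -> : Num.sqrt (P i i) * ((g t i)%:R / Num.sqrt (eta i)) *
  ((g t i)%:R / Num.sqrt (eta i)) * Num.sqrt (P i i) =
   (g t i)%:R ^+ 2 * (Num.sqrt (P i i) ^+ 2 / Num.sqrt (eta i) ^+ 2).
  by rewrite -exprVn; ring.
rewrite !sqr_sqrtr//; case: (g t i); first by rewrite expr1n !mul1r.
by rewrite expr0n !mul0r mulr0.
Qed.
End sketch.

(** Mutual independence is applied to the two-element index set with a constant family of events. *)
Lemma mutually_independent_pair (R : realType) (d d' : measure_display)
    (Omega : measurableType d) (T : measurableType d')
    (Pr : probability Omega R) (I : finType) (X : I -> {RV Pr >-> T})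
    (i j : I) (B : set T) :
  mutually_independent X -> i != j -> measurable B ->
  (Pr (X i @^-1` B `&` X j @^-1` B) = Pr (X i @^-1` B) * Pr (X j @^-1` B))%E.
Proof.
move=> indep ij mB; have := indep [set i; j]%SET (fun=> B) (fun _ _ => mB).
rewrite big_setU1 ?inE//= big_set1 => <-; congr (Pr _).
apply/seteqP; split => [w [Bi Bj] k /=|w Bw].
  by rewrite !inE => /orP[] /eqP ->.
by split; apply: Bw; rewrite /= !inE eqxx ?orbT.
Qed.

Lemma bernoulli_prob_true (R : realType) (p : R) : 0 <= p <= 1 ->
  bernoulli_prob p [set true] = p%:E.
Proof.
move=> p01; rewrite bernoulli_probE// !diracE mem_set// memNset//.
by rewrite mule1 mule0 adde0.
Qed.

Theorem lemma5p5 (R : realType) (d : measure_display) (Omega : measurableType d)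
    (Pr : probability Omega R) (N s : nat) (ltsN : (s < N)%N)
    (P : 'M[R]_N) (Pdiag : is_diag_mx P) (Ppos : forall i, 0 < P i i)
    (U : 'M[R]_(N, s)) (Uorth : U^T *m U = 1%:M)
    (c nu : nat) (c_gt0 : (0 < c)%N) (nu_gt0 : (0 < nu)%N)
    (eta : 'I_N -> R)
    (etaE : forall i, eta i = Num.min 1 (c%:R * leverage_prob U i))
    (eta_gt0 : forall i, 0 < eta i)
    (gamma : 'I_nu -> 'I_N -> {RV Pr >-> bool})
    (gamma_bernoulli : forall t i,
       distribution Pr (gamma t i) =1 bernoulli_prob (eta i))
    (gamma_indep : mutually_independent
       (fun ti : 'I_nu * 'I_N => gamma ti.1 ti.2)) :
  let Y := gram U P in
  let Ybar := fun w : Omega => avg_sketch U P eta (fun t i => gamma t i w) in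
  frobenius_variance Pr Ybar =
    (nu%:R^-1 *
      \sum_i ((eta i)^-1 - 1) * P i i ^+ 2 * leverage U i ^+ 2)%:E
  /\
  ((forall i, eta i = c%:R / s%:R * leverage U i /\ eta i < 2^-1) ->
   (frobenius_variance Pr Ybar <=
     (nu%:R^-1 *
       \sum_i P i i ^+ 2 * (s%:R / c%:R - leverage U i) * leverage U i)%:E)%E
   /\
   (forall eps : R, 0 < eps ->
     (Pr [set w | (eps <= frobenius_norm (Ybar w - Y))%R] <=
       (s%:R / (nu%:R * c%:R * eps ^+ 2) *
         \sum_i P i i ^+ 2 * leverage U i)%:E)%E)).
Proof.
move=> Y Ybar.
(* All entries of [Ybar] are weighted sums of indicators of the same events [A]; only the
   deterministic weights [a h k] depend on the entry. *)
pose A (ti : 'I_nu * 'I_N) := gamma ti.1 ti.2 @^-1` [set true].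
pose a h k (ti : 'I_nu * 'I_N) :=
  nu%:R^-1 * (P ti.2 ti.2 / eta ti.2 * (U ti.2 h * U ti.2 k)).
have mA ti : measurable (A ti) by exact: measurable_funPTI.
have PrA ti : Pr (A ti) = (eta ti.2)%:E.
  rewrite -[LHS]/(distribution Pr (gamma ti.1 ti.2) [set true]) gamma_bernoulli.
  (* The minimum with 1 in [etaE] makes [eta] an admissible Bernoulli parameter. *)
  by rewrite bernoulli_prob_true// (ltW (eta_gt0 _)) etaE ge_min lexx.
have Aindep ti tj : ti != tj -> (Pr (A ti `&` A tj) = Pr (A ti) * Pr (A tj))%E.
  by move=> ij; exact: (mutually_independent_pair gamma_indep ij).
have YbarE h k :
    (fun w => Ybar w h k) = fun w => \sum_ti \1_(A ti) w * a h k ti.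
  apply/funext => w; rewrite /Ybar avg_sketchE => [|i|i]; try exact: ltW.
  apply: eq_bigr => ti _; congr ((nat_of_bool _)%:R * _).
  by apply/idP/idP; rewrite in_setE.
have mY h k : measurable_fun setT (fun w => Ybar w h k).
  by rewrite YbarE; exact: measurable_weighted_indic.
have nu0 : nu%:R != 0 :> R by rewrite pnatr_eq0 -lt0n.
have eta0 i : eta i != 0 by rewrite gt_eqF.
(* The sketch is unbiased: the success probability cancels the division by [eta i], and the [nu]
   identical rounds cancel [nu%:R^-1]. *)
have EY h k : ('E_Pr[fun w => Ybar w h k] = (Y h k)%:E)%E.
  rewrite YbarE (expectation_weighted_indic _ mA PrA); congr EFin.
  rewrite -(pair_bigA _ (fun _ i =>
    eta i * (nu%:R^-1 * (P i i / eta i * (U i h * U i k)))))/=.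
  rewrite sumr_const card_ord.
  have PE : P = diag_mx (\row_i P i i).
    apply/matrixP => i j; rewrite !mxE; case: eqVneq => [->//|ij].
    by rewrite (is_diag_mxP Pdiag).
  rewrite /Y PE gram_diagE -sumrMnl; apply: eq_bigr => i _.
  by rewrite !mxE eqxx mulr1n -[LHS]mulr_natl; field; rewrite eta0.
have VY : frobenius_variance Pr Ybar =
    (nu%:R^-1 *
      \sum_i ((eta i)^-1 - 1) * P i i ^+ 2 * leverage U i ^+ 2)%:E.
  rewrite /frobenius_variance.
  under eq_bigr do under eq_bigr do
    rewrite YbarE (variance_weighted_indic _ mA PrA Aindep).
  under eq_bigr do rewrite sumEFin.
  rewrite sumEFin; congr EFin.
  under eq_bigr do rewrite exchange_big/=.
  rewrite exchange_big/=.
  (* With the sum over [(t, i)] outermost, each pair contributes through (p/eta)^2 eta (1 - eta) =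
     p^2 (1/eta - 1). The result does not depend on [t], so the [nu] rounds turn the factor nu^-2
     into nu^-1. *)
  transitivity (\sum_(ti : 'I_nu * 'I_N) nu%:R^-1 ^+ 2 *
      (((eta ti.2)^-1 - 1) * P ti.2 ti.2 ^+ 2 * leverage U ti.2 ^+ 2)).
    apply: eq_bigr => -[t i] _ /=.
    rewrite leverage_sqr !mulr_sumr; apply: eq_bigr => h _.
    rewrite !mulr_sumr; apply: eq_bigr => k _.
    by rewrite /a /=; field; rewrite eta0.
  rewrite -(pair_bigA _ (fun t i => nu%:R^-1 ^+ 2 *
      (((eta i)^-1 - 1) * P i i ^+ 2 * leverage U i ^+ 2)))/=.
  by rewrite sumr_const card_ord -mulr_sumr -[LHS]mulr_natl; field.
split=> // hc.
have c0 : 0 < c%:R :> R by rewrite ltr0n.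
have sc i : s%:R / c%:R * eta i = leverage U i.
  have [etai _] := hc i.
  (* If [s] were 0, the convention that the inverse of 0 is 0 would give [eta i = 0], against
     positivity. *)
  have s0 : s%:R != 0 :> R.
    by apply: contraNneq (eta0 i) => s0; rewrite etai s0 invr0 mulr0 mul0r.
  by rewrite etai; field; rewrite s0 pnatr_eq0 -lt0n.
(* The variance bound holds with equality: substituting l = (s/c) eta turns both (1/eta - 1) l^2 and
   (s/c - l) l into (s/c)^2 eta (1 - eta). *)
have VE : frobenius_variance Pr Ybar =
   (nu%:R^-1 *
       \sum_i P i i ^+ 2 * (s%:R / c%:R - leverage U i) * leverage U i)%:E.
  rewrite VY; congr (_ * _)%:E; apply: eq_bigr => i _.
  by rewrite -(sc i); field; rewrite eta0 gt_eqF.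
split=> [|eps eps0]; first by rewrite VE.
apply: (le_trans (frobenius_chebyshev mY EY eps0)).
rewrite VE -EFinM lee_fin.
(* Moving s/c inside the sum allows a termwise comparison, where s/c - l is bounded by s/c because l
   is nonnegative. *)
have -> : s%:R / (nu%:R * c%:R * eps ^+ 2) * (\sum_i P i i ^+ 2 * leverage U i)
  = eps ^- 2 * (nu%:R^-1 * \sum_i P i i ^+ 2 * (s%:R / c%:R) * leverage U i).
  rewrite !mulr_sumr; apply: eq_bigr => i _.
  by field; rewrite nu0 !gt_eqF.
rewrite ler_pM2l ?invr_gt0 ?exprn_gt0// ler_pM2l ?invr_gt0 ?ltr0n//.
apply: ler_sum => i _.
have lev0 : 0 <= leverage U i by exact: sqr_ge0.
by rewrite ler_wpM2r// ler_wpM2l ?sqr_ge0// gerBl.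
Qed.
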